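(* Fix a parameter $\boldsymbol{m}$. Let $\widetilde{\mathcal L}^u_{\rm norm}(\boldsymbol{m})$ be the infinite-shot normalized loss and $\widehat{\mathcal L}^u_{\rm norm}(\boldsymbol{m})$ its finite-shot estimator obtained from independent circuit repetitions ($N_H$ Hadamard-test runs and $N_q$ success-probability runs). Suppose that the Hadamard-test probability satisfies $p_H^u(\boldsymbol{m})>0$ and the projected success probability satisfies $p_{\rm succ}(\boldsymbol{m})>0$. Then for any prescribed failure probability $\rho\in(0,1)$ and statistical accuracy $0<\epsilon_{\rm stat}<1$, the estimator (with suitably chosen numbers of repetitions $N_H,N_q$) satisfies $$\mathbb P\left(\left|\widehat{\mathcal L}^u_{\rm norm}(\boldsymbol{m})-\widetilde{\mathcal L}^u_{\rm norm}(\boldsymbol{m})\right|\leq\epsilon_{\rm stat}\right)\geq 1-\rho .$$ Each Hadamard-test circuit queries both $O_{\rm prep}$ and $O_{\rm obs}$ once, while each circuit for estimating $p_{\rm succ}(\boldsymbol{m})$ queries $O_{\rm prep}$ once. The numbers of queries to $O_{\rm prep}$ and to $O_{\rm obs}$ required to achieve the prescribed statistical accuracy both satisfy $$\mathcal O\left(\frac{\lambda(\boldsymbol{m})^2\,\|\boldsymbol{u}_0\|^2}{\|\widetilde{\boldsymbol{u}}_T(\boldsymbol{m})\|^2\,\epsilon_{\rm stat}^2}\,\log\frac1\rho\right),$$ where the scaling factor $\lambda(\boldsymbol{m})>0$ depends on the quantum PDE solver.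
   Context: Setting. Let $n_x\ge1$ be an integer, $\boldsymbol{u}_0,\boldsymbol{u}_{\rm obs}$ nonzero vectors in $\mathbb{R}^{n_x}$ (initial data and observation), $\widetilde{\boldsymbol{u}}_T(\boldsymbol{m})\in\mathbb{C}^{n_x}$ nonzero (the approximate terminal PDE solution at parameter $\boldsymbol{m}$ encoded by the quantum solver), and $\lambda(\boldsymbol{m})>0$ a solver-dependent scaling factor with $\|\widetilde{\boldsymbol{u}}_T(\boldsymbol{m})\|\le\lambda(\boldsymbol{m})\|\boldsymbol{u}_0\|$. For a nonzero vector $\boldsymbol{v}\in\mathbb{C}^{n_x}$, $|\boldsymbol{v}\rangle=\|\boldsymbol{v}\|^{-1}\sum_{j=0}^{n_x-1}v_{j+1}|j\rangle$ denotes its normalized amplitude encoding in a system register with orthonormal basis states $|j\rangle$. The quantum PDE solver is a unitary $U_{\rm solver}(\boldsymbol{m})$ (including the initial-state preparation) acting on $a$ auxiliary qubits and the system register, with $$|\psi_T(\boldsymbol{m})\rangle:=U_{\rm solver}(\boldsymbol{m})|0\rangle=\frac{\|\widetilde{\boldsymbol{u}}_T(\boldsymbol{m})\|}{\lambda(\boldsymbol{m})\|\boldsymbol{u}_0\|}\,|0\rangle^{\otimes a}|\widetilde{\boldsymbol{u}}_T(\boldsymbol{m})\rangle+|\Phi_T^{\perp}(\boldsymbol{m})\rangle,\qquad P_u|\Phi_T^{\perp}(\boldsymbol{m})\rangle=0,$$ where $P_u=(|0\rangle\langle0|)^{\otimes a}\otimes I$. The observation state is $|\psi_{\rm obs}\rangle=|0\rangle^{\otimes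 a}|\boldsymbol{u}_{\rm obs}\rangle$. $O_{\rm prep}$ is the initial-state oracle preparing $|\boldsymbol{u}_0\rangle$ from $|0\rangle$ (used inside $U_{\rm solver}(\boldsymbol{m})$), and $O_{\rm obs}$ is the observation-state oracle with $O_{\rm obs}|0\rangle=|\psi_{\rm obs}\rangle$. Probabilities. The projected success probability and the Hadamard-test probability (probability of outcome $0$ in the Hadamard test for the unitary $O_{\rm obs}^\dagger U_{\rm solver}(\boldsymbol{m})$ on the all-zero state) are $$p_{\rm succ}(\boldsymbol{m})=\|P_u|\psi_T(\boldsymbol{m})\rangle\|^2=\frac{\|\widetilde{\boldsymbol{u}}_T(\boldsymbol{m})\|^2}{\lambda(\boldsymbol{m})^2\|\boldsymbol{u}_0\|^2},\qquad p_H^u(\boldsymbol{m})=\frac{1+\mathrm{Re}\langle\psi_{\rm obs}|\psi_T(\boldsymbol{m})\rangle}{2},$$ so that $2p_H^u(\boldsymbol{m})-1=\mathrm{Re}\langle\boldsymbol{u}_{\rm obs},\widetilde{\boldsymbol{u}}_T(\boldsymbol{m})\rangle/(\lambda(\boldsymbol{m})\|\boldsymbol{u}_0\|\|\boldsymbol{u}_{\rm obs}\|)$. Losses. The infinite-shot normalized loss is $$\widetilde{\mathcal L}^u_{\rm norm}(\boldsymbol{m})=2-2\frac{\mathrm{Re}\langle\boldsymbol{u}_{\rm obs},\widetilde{\boldsymbol{u}}_T(\boldsymbol{m})\rangle}{\|\boldsymbol{u}_{\rm obs}\|\|\widetilde{\boldsymbol{u}}_T(\boldsymbol{m})\|}=2-\frac{4p_H^u(\boldsymbol{m})-2}{\sqrt{p_{\rm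 succ}(\boldsymbol{m})}}.$$ The finite-shot estimator is $$\widehat{\mathcal L}^u_{\rm norm}(\boldsymbol{m})=2-\frac{4\widehat p_H^u(\boldsymbol{m})-2}{\sqrt{\widehat p_{\rm succ}(\boldsymbol{m})}},$$ where $\widehat p_H^u(\boldsymbol{m})$ and $\widehat p_{\rm succ}(\boldsymbol{m})$ are the empirical frequencies obtained from $N_H$ independent Hadamard-test runs (each a Bernoulli trial with success probability $p_H^u(\boldsymbol{m})$) and $N_q$ independent projected-success measurements (each a Bernoulli trial with success probability $p_{\rm succ}(\boldsymbol{m})$), respectively.
   Formalization: The query bound O(… log(1/ρ)) is proved with a constant uniform over ρ ≤ ρ0 for each fixed ρ0 < 1; one constant for all ρ in (0,1) is impossible, since log(1/ρ) tends to 0 as ρ tends to 1 while at least one run of each kind is needed. *)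

(* Defs.v *)
From HB Require Import structures.
From mathcomp Require Import all_boot all_order all_algebra.
From mathcomp Require Import all_classical all_reals all_analysis.
From mathcomp Require Import complex mxtens.

Set Implicit Arguments.
Unset Strict Implicit.
Unset Printing Implicit Defensive.

Import Order.TTheory GRing.Theory Num.Theory.
Local Open Scope ring_scope.
Local Open Scope complex_scope.
Local Open Scope sesquilinear_scope.

(* The library norm on matrices is the sup norm, hence the explicit Hermitian
   inner product (conjugate-linear on the left) and Euclidean norm. *)
Definition cdot (R : realType) (n : nat) (u v : 'cV[R[i]]_n) : R[i] :=
  (u^t* *m v) 0 0.

Definition vnorm (R : realType) (n : nat) (v : 'cV[R[i]]_n) : R :=
  Num.sqrt (complex.Re (cdot v v)).

Definition cplx (R : realType) (n : nat) (v : 'cV[R]_n) : 'cV[R[i]]_n :=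
  map_mx (real_complex R) v.

Definition ket (R : realType) (n k : nat) : 'cV[R[i]]_n :=
  \col_i (val i == k)%:R.

Definition amp (R : realType) (n : nat) (v : 'cV[R[i]]_n) : 'cV[R[i]]_n :=
  ((vnorm v)^-1)%:C *: v.

Definition born (R : realType) (n : nat) (Pi : 'M[R[i]]_n) (psi : 'cV[R[i]]_n)
  : R := vnorm (Pi *m psi) ^+ 2.

Definition hadamard_mx (R : realType) : 'M[R[i]]_2 :=
  ((Num.sqrt 2)^-1)%:C *: \matrix_(i, j) (-1) ^+ (i * j).

Lemma hadamard_unitary (R : realType) : hadamard_mx R \is unitarymx.
Proof.
apply/unitarymxP/matrixP => i j; rewrite !mxE !big_ord_recl big_ord0 !mxE /=.
set c := (Num.sqrt (2 : R))^-1%:C.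
have c2 : c * c = 2^-1.
  by rewrite -rmorphM -invfM -expr2 sqr_sqrtr ?ler0n// fmorphV rmorph_nat.
have cc : Num.conj c = c by exact: conjc_real.
have half : 2^-1 + 2^-1 = 1 :> R[i] by rewrite [RHS]splitr mul1r.
case: i => [[|[|//]] ?]; case: j => [[|[|//]] ?];
  by rewrite /= ?expr0 ?expr1 !rmorphM ?rmorphN !rmorph1 /= cc
     ?(mulr1, mulrN1, mulrN, mulNr, opprK) c2 addr0 ?subrr ?half.
Qed.

(* Quantum circuits with oracle access, indexed by the dimension of the space
   they act on; the gates that query no oracle are arbitrary unitaries.
   The [a] auxiliary qubits are a space of dimension 2 ^ a, whose basis vector
   [ket R (2 ^ a) 0] is the a-fold tensor power of |0>; the system register
   has dimension [nx]. *)
Inductive circuit (R : realType) (nx a : nat) : nat -> Type :=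
| Gate n (U : 'M[R[i]]_n) of U \is unitarymx : circuit R nx a n
| QueryPrep : circuit R nx a nx
| QueryObs : circuit R nx a (2 ^ a * nx)
| Adjoint n : circuit R nx a n -> circuit R nx a n
| Compose n : circuit R nx a n -> circuit R nx a n -> circuit R nx a n
| OnLeft m n : circuit R nx a m -> circuit R nx a (m * n)
| OnRight m n : circuit R nx a n -> circuit R nx a (m * n)
| Control n : circuit R nx a n -> circuit R nx a (2 * n).

Arguments QueryPrep {R nx a}.
Arguments QueryObs {R nx a}.

(* [Compose c d] runs [c] first. *)
Fixpoint run (R : realType) (nx a : nat)
    (Oprep : 'M[R[i]]_nx) (Oobs : 'M[R[i]]_(2 ^ a * nx))
    (n : nat) (c : circuit R nx a n) : 'M[R[i]]_n :=
  match c in circuit _ _ _ n return 'M[R[i]]_n with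
  | Gate _ U _ => U
  | QueryPrep => Oprep
  | QueryObs => Oobs
  | Adjoint _ c => (run Oprep Oobs c)^t*
  | Compose _ c d => run Oprep Oobs d *m run Oprep Oobs c
  | OnLeft _ _ c => run Oprep Oobs c *t 1%:M
  | OnRight _ _ c => 1%:M *t run Oprep Oobs c
  | Control _ c => delta_mx 0 0 *t 1%:M + delta_mx 1 1 *t run Oprep Oobs c
  end.

Fixpoint prep_queries (R : realType) (nx a n : nat) (c : circuit R nx a n)
  : nat :=
  match c with
  | Gate _ _ _ => 0
  | QueryPrep => 1
  | QueryObs => 0
  | Adjoint _ c => prep_queries c
  | Compose _ c d => prep_queries c + prep_queries d
  | OnLeft _ _ c => prep_queries c
  | OnRight _ _ c => prep_queries c
  | Control _ c => prep_queries c
  end.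

Fixpoint obs_queries (R : realType) (nx a n : nat) (c : circuit R nx a n)
  : nat :=
  match c with
  | Gate _ _ _ => 0
  | QueryPrep => 0
  | QueryObs => 1
  | Adjoint _ c => obs_queries c
  | Compose _ c d => obs_queries c + obs_queries d
  | OnLeft _ _ c => obs_queries c
  | OnRight _ _ c => obs_queries c
  | Control _ c => obs_queries c
  end.

Definition hadamard_test (R : realType) (nx a n : nat) (c : circuit R nx a n)
  : circuit R nx a (2 * n) :=
  let H := OnLeft n (Gate nx a (hadamard_unitary R)) in
  Compose H (Compose (Control c) H).

(* Hadamard test for the unitary Oobs^* U_solver. *)
Definition overlap_test (R : realType) (nx a : nat)
    (solver : circuit R nx a (2 ^ a * nx))
  : circuit R nx a (2 * (2 ^ a * nx)) :=
  hadamard_test (Compose solver (Adjoint QueryObs)).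

(* Running the solver and measuring [proj_u], defined below. *)
Definition succ_test (R : realType) (nx a : nat)
    (solver : circuit R nx a (2 ^ a * nx)) : circuit R nx a (2 ^ a * nx) :=
  solver.

Definition total_queries (R : realType) (nx a : nat)
    (queries : forall n, circuit R nx a n -> nat)
    (solver : circuit R nx a (2 ^ a * nx)) (NH Nq : nat) : nat :=
  NH * queries _ (overlap_test solver) + Nq * queries _ (succ_test solver).

Definition zero_state (R : realType) (nx a : nat) : 'cV[R[i]]_(2 ^ a * nx) :=
  ket R (2 ^ a) 0 *t ket R nx 0.

Definition encoded (R : realType) (nx a : nat) (v : 'cV[R[i]]_nx)
  : 'cV[R[i]]_(2 ^ a * nx) :=
  ket R (2 ^ a) 0 *t amp v.

Definition proj_u (R : realType) (nx a : nat) : 'M[R[i]]_(2 ^ a * nx) :=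
  (ket R (2 ^ a) 0 *m (ket R (2 ^ a) 0)^t*) *t 1%:M.

Definition p_H (R : realType) (nx a : nat)
    (Oprep : 'M[R[i]]_nx) (Oobs : 'M[R[i]]_(2 ^ a * nx))
    (solver : circuit R nx a (2 ^ a * nx)) : R :=
  born (delta_mx 0 0 *t 1%:M)
    (run Oprep Oobs (overlap_test solver) *m (ket R 2 0 *t zero_state R nx a)).

Definition p_succ (R : realType) (nx a : nat)
    (Oprep : 'M[R[i]]_nx) (Oobs : 'M[R[i]]_(2 ^ a * nx))
    (solver : circuit R nx a (2 ^ a * nx)) : R :=
  born (proj_u R nx a) (run Oprep Oobs (succ_test solver) *m zero_state R nx a).

Definition norm_loss (R : realType) (nx : nat) (uobs : 'cV[R]_nx)
    (uT : 'cV[R[i]]_nx) : R :=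
  2 - 2 * (complex.Re (cdot (cplx uobs) uT) / (vnorm (cplx uobs) * vnorm uT)).

Definition loss_estimate (R : realType) (pH ps : R) : R :=
  2 - (4 * pH - 2) / Num.sqrt ps.

Definition freq (R : realType) (T : Type) (N : nat) (X : 'I_N -> T -> bool)
    (w : T) : R :=
  (\sum_(i < N) (X i w)%:R) / N%:R.

Definition independent_runs (R : realType) (d : measure_display)
    (T : measurableType d) (P : probability T R) (I : finType)
    (X : I -> {RV P >-> bool}) : Prop :=
  forall (J : {set I}) (B : I -> set bool),
    P (\bigcap_(i in [set` J]) (X i @^-1` B i))%classic
      = (\prod_(i in J) P (X i @^-1` B i)%classic)%E.

(* [N] independent Bernoulli trials with success probability [p]. *)
Definition bernoulli_trials (R : realType) (d : measure_display)
    (T : measurableType d) (P : probability T R) (N : nat) (p : R)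
    (X : 'I_N -> {RV P >-> bool}) : Prop :=
  independent_runs X /\ forall i, distribution P (X i) =1 bernoulli_prob p.

(* The estimator divides by the square root of the frequency of [Y]; as
   division by zero is total here, the event asks this frequency to be
   positive. *)
Definition accurate (R : realType) (d : measure_display) (T : measurableType d)
    (P : probability T R) (nx : nat) (uobs : 'cV[R]_nx) (uT : 'cV[R[i]]_nx)
    (eps : R) (NH Nq : nat)
    (X : 'I_NH -> {RV P >-> bool}) (Y : 'I_Nq -> {RV P >-> bool}) : set T :=
  [set w | 0 < freq R Y w /\
     `|loss_estimate (freq R X w) (freq R Y w) - norm_loss uobs uT| <= eps]%classic.

(* Main.v *)
(* Write s = |uT| / (lambda |u0|) <= 1 and c = Re <uobs|uT>. The circuits give
   p_succ = s^2 and p_H = (1 + s c) / 2, and the loss is 2 - 2 c. The estimate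
   is eps-accurate as soon as p_H is known up to an additive error eps s / 8 and
   p_succ up to a relative error eps / 8. Hoeffding's inequality would need
   1 / s^4 samples for the latter; a Chernoff bound, which exploits the variance
   p_succ of each trial, needs only 1 / s^2. A union bound over the two
   experiments concludes. *)
Require Import Defs.
From mathcomp Require Import all_boot all_order all_algebra.
From mathcomp Require Import all_classical all_reals all_analysis.
From mathcomp Require Import complex mxtens.
From mathcomp Require Import ring lra.
Import Order.TTheory GRing.Theory Num.Theory.
Local Open Scope classical_set_scope.
Local Open Scope ring_scope.
Local Open Scope complex_scope.
Local Open Scope sesquilinear_scope.

(** * Hermitian inner product and Euclidean norm on columns *)

Section InnerProduct.
Context {R : realType} {n : nat}.
Implicit Types (u v w : 'cV[R[i]]_n) (A : 'M[R[i]]_n).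

Lemma ReD (x y : R[i]) : complex.Re (x + y) = complex.Re x + complex.Re y.
Proof. by case: x; case: y. Qed.

Lemma ReN (x : R[i]) : complex.Re (- x) = - complex.Re x.
Proof. by case: x. Qed.

Lemma ReZ (a : R) (x : R[i]) : complex.Re (a%:C * x) = a * complex.Re x.
Proof. by case: x => b c /=; rewrite mul0r subr0. Qed.

Lemma adjmxM m p q (A : 'M[R[i]]_(m, p)) (B : 'M[R[i]]_(p, q)) :
  (A *m B)^t* = B^t* *m A^t*.
Proof. by rewrite trmx_mul map_mxM. Qed.

Lemma cdotDl u v w : cdot (u + v) w = cdot u w + cdot v w.
Proof. by rewrite /cdot linearD/= map_mxD mulmxDl mxE. Qed.

Lemma cdotDr u v w : cdot u (v + w) = cdot u v + cdot u w.
Proof. by rewrite /cdot mulmxDr mxE. Qed.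

Lemma cdotNl u v : cdot (- u) v = - cdot u v.
Proof. by rewrite /cdot linearN/= map_mxN mulNmx mxE. Qed.

Lemma cdotNr u v : cdot u (- v) = - cdot u v.
Proof. by rewrite /cdot mulmxN mxE. Qed.

Lemma cdotZr a u v : cdot u (a *: v) = a * cdot u v.
Proof. by rewrite /cdot -scalemxAr mxE. Qed.

Lemma cdotv0 u : cdot u 0 = 0.
Proof. by rewrite /cdot mulmx0 mxE. Qed.

Lemma cdotC u v : cdot v u = Num.conj (cdot u v).
Proof.
rewrite /cdot !mxE rmorph_sum; apply: eq_bigr => i _.
by rewrite !mxE rmorphM /= conjCK mulrC.
Qed.

Lemma Re_cdotC u v : complex.Re (cdot v u) = complex.Re (cdot u v).
Proof. by rewrite cdotC; case: (cdot u v). Qed.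

Lemma cdotZl (a : R) u v : cdot (a%:C *: u) v = a%:C * cdot u v.
Proof.
by rewrite cdotC cdotZr rmorphM [in RHS]cdotC; congr (_ * _); exact: conjc_real.
Qed.

Lemma cdot_adj A u v : cdot (A *m u) v = cdot u (A^t* *m v).
Proof. by rewrite /cdot adjmxM mulmxA. Qed.

Lemma cdotvv u :
  cdot u u = (\sum_i (complex.Re (u i 0) ^+ 2 + complex.Im (u i 0) ^+ 2))%:C.
Proof.
rewrite /cdot mxE rmorph_sum; apply: eq_bigr => i _.
by apply: etrans (esym (add_Re2_Im2 _)); rewrite !mxE normCK mulrC.
Qed.

Lemma Re_cdotvv_ge0 u : 0 <= complex.Re (cdot u u).
Proof. by rewrite cdotvv /= sumr_ge0 // => i _; rewrite addr_ge0 ?sqr_ge0. Qed.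

Lemma vnorm_ge0 u : 0 <= vnorm u.
Proof. exact: sqrtr_ge0. Qed.

Lemma vnorm_sqr u : vnorm u ^+ 2 = complex.Re (cdot u u).
Proof. by rewrite sqr_sqrtr // Re_cdotvv_ge0. Qed.

Lemma vnorm_gt0 u : u != 0 -> 0 < vnorm u.
Proof.
move=> u0; rewrite lt_def vnorm_ge0 andbT; apply: contra u0 => /eqP nu0.
have : vnorm u ^+ 2 == 0 by rewrite nu0 expr0n.
rewrite vnorm_sqr cdotvv /= psumr_eq0 => [/allP u0|i _]; last first.
  by rewrite addr_ge0 ?sqr_ge0.
apply/eqP/matrixP => i j; rewrite ord1 mxE.
have /= := u0 i (mem_index_enum _).
rewrite paddr_eq0 ?sqr_ge0 // !sqrf_eq0 => /andP[/eqP ri /eqP ii].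
by apply/eqP; rewrite eq_complex ri ii /= !eqxx.
Qed.

Lemma vnormZ (a : R) u : 0 <= a -> vnorm (a%:C *: u) = a * vnorm u.
Proof.
move=> a0; rewrite /vnorm cdotZl cdotZr !ReZ mulrA -expr2 sqrtrM ?sqr_ge0 //.
by rewrite sqrtr_sqr ger0_norm.
Qed.

Lemma vnorm_amp u : u != 0 -> vnorm (amp u) = 1.
Proof.
move=> u0; rewrite /amp vnormZ ?invr_ge0 ?vnorm_ge0 // mulVf //.
by rewrite gt_eqF ?vnorm_gt0.
Qed.

Lemma vnorm_unitary A u : A \is unitarymx -> vnorm (A *m u) = vnorm u.
Proof.
move=> uA; rewrite /vnorm cdot_adj mulmxA.
by rewrite -[A^t* *m A]mul1mx mulmxA mulmxKtV // mul1mx.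
Qed.

Lemma vnormD_sqr u v :
  vnorm (u + v) ^+ 2 = vnorm u ^+ 2 + 2 * complex.Re (cdot u v) + vnorm v ^+ 2.
Proof.
rewrite !vnorm_sqr cdotDl !cdotDr !ReD (Re_cdotC u v).
move: (cdot u u) (cdot u v) (cdot v v) => x y z; ring.
Qed.

(** The squared norms of [u + v] and [u - v] are [2 + 2 Re <u,v>] and [2 - 2 Re <u,v>], and both are
    nonnegative; this real form of Cauchy-Schwarz is enough for the loss. *)
Lemma Re_cdot_unit u v : vnorm u = 1 -> vnorm v = 1 ->
  `|complex.Re (cdot u v)| <= 1.
Proof.
move=> u1 v1.
have nv1 : vnorm (- v) = 1 by rewrite /vnorm cdotNr cdotNl opprK.
have := vnormD_sqr u (- v); have := vnormD_sqr u v.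
rewrite u1 v1 nv1 cdotNr ReN ler_norml.
have := sqr_ge0 (vnorm (u + v)); have := sqr_ge0 (vnorm (u - v)).
move: (vnorm (u + v)) (vnorm (u - v)) (complex.Re (cdot u v)) => x y z; lra.
Qed.

Lemma Re_cdot_amp u v :
  complex.Re (cdot (amp u) (amp v)) = complex.Re (cdot u v) / (vnorm u * vnorm v).
Proof. by rewrite /amp cdotZl cdotZr !ReZ invfM; ring. Qed.

End InnerProduct.

(** * Tensor products of columns *)

Section Tensor.
Context {R : realType}.

(* A tensor product of columns has width [1 * 1], which is convertible to [1] but
   blocks rewriting with [tensmx_mul]; hence the versions for columns. *)
Lemma tens_mulcv m n p q (A : 'M[R[i]]_(m, n)) (B : 'M[R[i]]_(p, q))
    (u : 'cV[R[i]]_n) (v : 'cV[R[i]]_q) :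
  (A *t B) *m (u *t v : 'cV_(n * q)) = (A *m u) *t (B *m v) :> 'cV_(m * p).
Proof. exact: (@tensmx_mul _ m n p q 1 1). Qed.

Lemma tens_cvDr m n (u : 'cV[R[i]]_m) (v w : 'cV[R[i]]_n) :
  (u *t v : 'cV_(m * n)) + (u *t w : 'cV_(m * n)) = u *t (v + w).
Proof. by apply/matrixP => i j; rewrite !mxE mulrDr. Qed.

Lemma tensmxZl m n p q (a : R[i]) (A : 'M[R[i]]_(m, n)) (B : 'M[R[i]]_(p, q)) :
  (a *: A) *t B = a *: (A *t B).
Proof. by apply/matrixP => i j; rewrite !mxE mulrA. Qed.

Lemma cdot_tens m n (u u' : 'cV[R[i]]_m) (v v' : 'cV[R[i]]_n) :
  cdot (u *t v : 'cV_(m * n)) (u' *t v' : 'cV_(m * n)) = cdot u u' * cdot v v'.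
Proof.
rewrite /cdot.
have -> : (u *t v : 'cV_(m * n))^t* = u^t* *t v^t* :> 'rV_(m * n).
  by rewrite -map_mxT; congr map_mx; exact: (@trmx_tens _ m 1 n 1).
have -> : u^t* *t v^t* *m (u' *t v' : 'cV_(m * n)) = (u^t* *m u') *t (v^t* *m v').
  exact: (@tensmx_mul _ 1 m 1 n 1 1).
(* The tensor product is a single entry of width [1 * 1]; writing its index as a pair lets [tensmxE]
   split it into the two inner products. *)
rewrite [LHS](_ : _ = ((u^t* *m u') *t (v^t* *m v'))
  (mxtens_index (0, 0)) (mxtens_index (0, 0))).
  by rewrite tensmxE.
by congr (fun_of_matrix _ _ _); apply: val_inj.
Qed.

Lemma cdot_ket n k : (k < n)%N -> cdot (ket R n k) (ket R n k) = 1.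
Proof.
move=> kn; rewrite /cdot mxE (bigD1 (Ordinal kn)) //= big1 => [|i ik].
  by rewrite !mxE eqxx rmorph1 mulr1 addr0.
rewrite !mxE (_ : _ == _ = false) ?mulr0 //.
by apply: contraNF ik => /eqP ik; apply/eqP/val_inj.
Qed.

Lemma vnorm_tens_ket m n k (v : 'cV[R[i]]_n) : (k < m)%N ->
  vnorm (ket R m k *t v : 'cV_(m * n)) = vnorm v.
Proof. by move=> km; rewrite /vnorm cdot_tens cdot_ket // mul1r. Qed.

End Tensor.

(** * The Hadamard test, and the states and projector of the solver *)

Section Circuits.
Context {R : realType} {nx a : nat}.
Variables (Oprep : 'M[R[i]]_nx) (Oobs : 'M[R[i]]_(2 ^ a * nx)).

(** Row 0 and column 0 of the Hadamard matrix are constant and positive, so on outcome 0 both values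
    [k] of the control qubit return with the same amplitude 1/2: the two branches of the controlled
    gate are added without a sign. *)
Lemma hadamard_branch (k : 'I_2) :
  delta_mx 0 0 *m (hadamard_mx R *m (delta_mx k k *m (hadamard_mx R *m ket R 2 0)))
  = (2^-1)%:C *: ket R 2 0.
Proof.
have c2 : ((Num.sqrt (2 : R))^-1)%:C * ((Num.sqrt 2)^-1)%:C = (2^-1)%:C.
  by rewrite -rmorphM -invfM -expr2 sqr_sqrtr ?ler0n.
apply/matrixP => i j; rewrite ord1 -c2 {j}.
rewrite !mxE !big_ord_recl big_ord0 !mxE !big_ord_recl !big_ord0 !mxE.
rewrite !big_ord_recl !big_ord0 !mxE !big_ord_recl !big_ord0 !mxE /=.
by case: i => [[|[|//]] ?]; case: k => [[|[|//]] ?];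
  rewrite /= ?expr0 ?expr1 !(mulr0, mul0r, add0r, addr0, mulr1, mul1r).
Qed.

(** With [V] the run of [c], outcome 0 leaves the vector [|0> (z + V z) / 2]. As [z] and [V z] have
    norm 1, its squared norm is [(2 + 2 Re <z, V z>) / 4]. *)
Lemma born_hadamard_test n (c : circuit R nx a n) (z : 'cV[R[i]]_n) :
  vnorm z = 1 -> vnorm (run Oprep Oobs c *m z) = 1 ->
  born (delta_mx 0 0 *t 1%:M)
    (run Oprep Oobs (hadamard_test c) *m (ket R 2 0 *t z : 'cV_(2 * n)))
  = (1 + complex.Re (cdot z (run Oprep Oobs c *m z))) / 2.
Proof.
move=> z1; rewrite /hadamard_test /=; set V := run _ _ c => Vz1.
rewrite /born -!mulmxA tens_mulcv mul1mx mulmxDl !tens_mulcv mul1mx !mulmxDr.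
rewrite !tens_mulcv !mul1mx !hadamard_branch !tensmxZl -scalerDr tens_cvDr.
rewrite vnormZ ?invr_ge0 ?ler0n // vnorm_tens_ket // exprMn vnormD_sqr z1 Vz1.
by field.
Qed.

Lemma vnorm_zero_state : (0 < nx)%N -> vnorm (zero_state R nx a) = 1.
Proof.
move=> nx0; rewrite vnorm_tens_ket ?expn_gt0 //.
by rewrite /vnorm cdot_ket //= sqrtr1.
Qed.

Lemma vnorm_encoded (v : 'cV[R[i]]_nx) : v != 0 -> vnorm (encoded a v) = 1.
Proof. by move=> v0; rewrite vnorm_tens_ket ?expn_gt0 // vnorm_amp. Qed.

Lemma proj_u_adj : (proj_u R nx a)^t* = proj_u R nx a.
Proof.
by rewrite /proj_u trmx_tens map_mxT adjmxM trmx1 map_mx1 trmxCK.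
Qed.

Lemma proj_u_encoded (v : 'cV[R[i]]_nx) :
  proj_u R nx a *m encoded a v = encoded a v.
Proof.
rewrite /proj_u /encoded tens_mulcv mul1mx -mulmxA.
rewrite [X in _ *m X](_ : _ = 1%:M) ?mulmx1 //.
by apply/matrixP => i j; rewrite !ord1 [RHS]mxE; apply: cdot_ket; rewrite expn_gt0.
Qed.

End Circuits.

(** * The two measured probabilities in terms of the scale [s] and the overlap *)

Section Solver.
Context {R : realType} {nx a : nat}.
Variables (Oprep : 'M[R[i]]_nx) (Oobs : 'M[R[i]]_(2 ^ a * nx)).
Variables (solver : circuit R nx a (2 ^ a * nx)).
Variables (s : R) (uT : 'cV[R[i]]_nx) (Phi : 'cV[R[i]]_(2 ^ a * nx)).
Hypotheses (s_ge0 : 0 <= s) (uT_neq0 : uT != 0).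
Hypothesis solver_out :
  run Oprep Oobs solver *m zero_state R nx a = s%:C *: encoded a uT + Phi.
Hypothesis proj_Phi : proj_u R nx a *m Phi = 0.

Lemma p_succE : p_succ Oprep Oobs solver = s ^+ 2.
Proof.
rewrite /p_succ /born solver_out mulmxDr proj_Phi addr0 -scalemxAr.
by rewrite proj_u_encoded vnormZ // vnorm_encoded // mulr1.
Qed.

Lemma p_HE (uobs : 'cV[R[i]]_nx) : (0 < nx)%N ->
  run Oprep Oobs solver \is unitarymx -> Oobs \is unitarymx ->
  Oobs *m zero_state R nx a = encoded a uobs ->
  p_H Oprep Oobs solver = (1 + s * complex.Re (cdot (amp uobs) (amp uT))) / 2.
Proof.
move=> nx0 solver_unitary Oobs_unitary obs_out; rewrite /p_H.
rewrite born_hadamard_test /= ?vnorm_zero_state //; last first.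
  by rewrite -mulmxA !vnorm_unitary ?trmxC_unitary ?vnorm_zero_state.
rewrite -mulmxA -cdot_adj obs_out solver_out cdotDr cdotZr ReD ReZ.
(* [Phi] is orthogonal to the observation state: that state is fixed by the self-adjoint [proj_u],
   which moves across the inner product and kills [Phi]. *)
rewrite cdot_tens cdot_ket ?expn_gt0 // mul1r -[encoded a uobs]proj_u_encoded.
by rewrite cdot_adj proj_u_adj proj_Phi cdotv0 /= addr0.
Qed.

End Solver.

(** * Chernoff bounds for Bernoulli trials *)

(** From [1 - t <= expR (- t)] one gets [(1 - t) * expR t <= 1], while [(1 - t) * (1 + t + 2 * t ^+
    2) = 1 + t ^+ 2 * (1 - 2 * t) >= 1]; divide by [1 - t > 0]. *)
Lemma expR_le_quadratic {R : realType} (t : R) : t <= 2^-1 ->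
  expR t <= 1 + t + 2 * t ^+ 2.
Proof.
move=> t2; have := expR_ge1Dx (- t); rewrite expRN => h.
have e0 := expR_gt0 t; have {h} : (1 - t) * expR t <= 1.
  by rewrite -ler_pdivlMr // div1r.
have : 0 <= t ^+ 2 * (1 - 2 * t) by rewrite mulr_ge0 ?sqr_ge0 //; lra.
by nra.
Qed.

Section BernoulliTails.
Context {R : realType} {d : measure_display} {T : measurableType d}.
Context {P : probability T R}.

Section FiniteRange.
Context {I : finType} (X : I -> {RV P >-> bool}).
Implicit Types (b : {ffun I -> bool}) (Q : {ffun I -> bool} -> Prop).

(** Every event about the trials is a condition on this finite-valued vector, hence a finite
    disjoint union of fibers. Measurability and probabilities thus reduce to finite sums, without
    integration. *)
Definition outcome (w : T) : {ffun I -> bool} := [ffun i => X i w].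

Lemma outcome_fiber b :
  outcome @^-1` [set b] = \bigcap_(i in [set` [set: I]%SET]) (X i @^-1` [set b i]).
Proof.
apply/seteqP; split => [w /= <- i _|w h]; first by rewrite /= ffunE.
by apply/ffunP => i; rewrite ffunE; apply: h; rewrite /= inE.
Qed.

Lemma measurable_outcome_fiber b : measurable (outcome @^-1` [set b]).
Proof.
rewrite outcome_fiber; apply: fin_bigcap_measurable => [|i _]; first exact: finite_finset.
by rewrite -[_ @^-1` _]setTI; exact: measurable_funP.
Qed.

Lemma outcome_preimage Q :
  [set w | Q (outcome w)] = \bigcup_(b in [set b | Q b]) (outcome @^-1` [set b]).
Proof.
by apply/seteqP; split => [w Qw|w [b Qb /= wb]]; [exists (outcome w)|rewrite /= wb].
Qed.

Lemma measurable_outcome Q : measurable [set w | Q (outcome w)].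
Proof.
rewrite outcome_preimage; apply: fin_bigcup_measurable => [|b _].
  exact: finite_finset.
exact: measurable_outcome_fiber.
Qed.

Lemma probability_outcome Q :
  P [set w | Q (outcome w)] = (\sum_(b | `[< Q b >]) P (outcome @^-1` [set b]))%E.
Proof.
rewrite bigfs ?index_enum_uniq //= => [|b _]; last by rewrite mem_index_enum.
rewrite outcome_preimage measure_fin_bigcup.
- by apply: eq_fsbigl; apply/seteqP; split => b; [exact: asboolT|exact: asboolW].
- exact: finite_finset.
- by move=> b b' _ _ [w [/= <- <-]].
- by move=> b _; exact: measurable_outcome_fiber.
Qed.

End FiniteRange.

(** The factor [p] in front of the quadratic term is what yields the multiplicative tail estimate;
    Hoeffding's lemma would have a constant there. *)
Lemma bernoulli_mgf (p t : R) : 0 <= p -> t <= 2^-1 ->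
  p * expR t + (1 - p) <= expR (p * (t + 2 * t ^+ 2)).
Proof.
move=> p0 t2; apply: le_trans (expR_ge1Dx _).
by have := ler_wpM2l p0 (expR_le_quadratic _ t2); lra.
Qed.

Lemma outcome_prob N (p : R) (X : 'I_N -> {RV P >-> bool}) (b : {ffun 'I_N -> bool}) :
  0 <= p <= 1 -> bernoulli_trials p X ->
  P (outcome X @^-1` [set b]) = (\prod_i bernoulli_pmf p (b i))%:E.
Proof.
move=> p01 [ind dist]; rewrite outcome_fiber ind -prodEFin.
rewrite [LHS](eq_bigl xpredT) => [|i]; last by rewrite inE.
apply: eq_bigr => i _.
have := dist i [set b i]; rewrite /distribution /pushforward /= => ->.
by rewrite /bernoulli_prob p01 fsbig_set1.
Qed.

Lemma sum_outcome N (X : 'I_N -> {RV P >-> bool}) w :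
  \sum_i (outcome X w i)%:R = \sum_(i < N) (X i w)%:R :> R.
Proof. by apply: eq_bigr => i _; rewrite ffunE. Qed.

(** The parameter [t] may have either sign, so this one bound serves the upper and the lower
    tail. *)
Lemma chernoff_bernoulli N (p t r : R) (X : 'I_N -> {RV P >-> bool}) :
  0 <= p <= 1 -> t <= 2^-1 -> bernoulli_trials p X ->
  (P [set w | (r <= t * (\sum_(i < N) (X i w)%:R - N%:R * p))%R]
    <= (expR (2 * N%:R * p * t ^+ 2 - r))%:E)%E.
Proof.
move=> p01 t2 trials; have /andP[p0 p1] := p01.
pose S (b : {ffun 'I_N -> bool}) : R := \sum_i (b i)%:R.
have -> : [set w | r <= t * (\sum_(i < N) (X i w)%:R - N%:R * p)]
    = [set w | r <= t * (S (outcome X w) - N%:R * p)].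
  by apply/seteqP; split => w /=; rewrite /S sum_outcome.
rewrite (probability_outcome X (fun b => r <= t * (S b - N%:R * p))).
under eq_bigr do rewrite (outcome_prob _ _ _ _ p01 trials).
rewrite sumEFin lee_fin.
(* Markov's inequality on the finite sum: the exponential weight is at least 1 on the event and
   nonnegative elsewhere. *)
apply: (@le_trans _ _
    (\sum_b expR (t * (S b - N%:R * p) - r) * \prod_i bernoulli_pmf p (b i))).
  rewrite big_mkcond /=; apply: ler_sum => b _; case: asboolP => h; last first.
    by rewrite mulr_ge0 ?expR_ge0 // prodr_ge0 // => i _; exact: bernoulli_pmf_ge0.
  rewrite ler_peMl //; last by rewrite -[leLHS]expR0 ler_expR subr_ge0.
  by rewrite prodr_ge0 // => i _; exact: bernoulli_pmf_ge0.
have -> : \sum_b expR (t * (S b - N%:R * p) - r) * \prod_i bernoulli_pmf p (b i)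
    = expR (- (t * N%:R * p) - r) * (p * expR t + (1 - p)) ^+ N.
  transitivity (\sum_(b : {ffun 'I_N -> bool}) expR (- (t * N%:R * p) - r) *
      \prod_i (expR (t * (b i)%:R) * bernoulli_pmf p (b i))).
    apply: eq_bigr => b _; rewrite big_split /= mulrA -expR_sum -expRD.
    by rewrite -mulr_sumr -/(S b); congr (expR _ * _); ring.
  (* By independence the summand is a product over the trials; the sum over all outcome vectors
     factors into [N] equal two-term sums. *)
  rewrite -mulr_sumr -(bigA_distr_bigA
    (fun (_ : 'I_N) (b : bool) => expR (t * b%:R) * bernoulli_pmf p b)).
  rewrite prodr_const card_ord big_bool /= mulr1 mulr0 expR0 mul1r.
  by rewrite [expR t * p]mulrC.
rewrite (le_trans (ler_wpM2l (expR_ge0 _)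
    (_ : _ <= expR (p * (t + 2 * t ^+ 2)) ^+ N))) //.
  rewrite lerXn2r ?bernoulli_mgf // nnegrE ?expR_ge0 //.
  by rewrite addr_ge0 ?mulr_ge0 ?expR_ge0 // subr_ge0.
rewrite -expRM_natl -expRD ler_expR le_eqVlt.
by apply/orP; left; apply/eqP; ring.
Qed.

Lemma freqE N (X : 'I_N -> {RV P >-> bool}) w :
  freq R X w = (\sum_i (outcome X w i)%:R) / N%:R.
Proof. by rewrite sum_outcome. Qed.

Lemma measurable_freq_tail N (p delta : R) (X : 'I_N -> {RV P >-> bool}) :
  measurable [set w | delta < `|freq R X w - p|].
Proof.
under eq_set do rewrite freqE.
exact: (measurable_outcome X
  (fun b => is_true (delta < `|(\sum_i (b i)%:R) / N%:R - p|))).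
Qed.

(* Allowing any bound [q] on [p] covers both the additive ([q = 1]) and the
   multiplicative ([q = p]) form of the tail estimate. *)
Lemma freq_tail N (p q delta : R) (X : 'I_N -> {RV P >-> bool}) :
  (0 < N)%N -> 0 <= p <= 1 -> 0 < q -> p <= q -> 0 < delta <= 2 * q ->
  bernoulli_trials p X ->
  (P [set w | (delta < `|freq R X w - p|)%R]
    <= (2 * expR (- (N%:R * delta ^+ 2 / (8 * q))))%:E)%E.
Proof.
move=> N0 p01 q0 pq /andP[d0 dq] trials; have /andP[p0 p1] := p01.
have N0R : 0 < N%:R :> R by rewrite ltr0n.
(* This [t] minimizes [2 * N * q * t ^+ 2 - N * delta * t], with minimum
   [- N * delta ^+ 2 / (8 * q)]; the hypothesis [delta <= 2 * q] is exactly [t <= 1 / 2]. *)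
pose t := delta / (4 * q); pose r := N%:R * delta * t.
have t0 : 0 < t by rewrite divr_gt0 // mulr_gt0.
have t2 : t <= 2^-1 by rewrite ler_pdivrMr ?mulr_gt0 //; lra.
pose tail u := [set w | r <= u * (\sum_(i < N) (X i w)%:R - N%:R * p)].
have mtail u : measurable (tail u).
  rewrite /tail; have -> : [set w | r <= u * (\sum_(i < N) (X i w)%:R - N%:R * p)]
      = [set w | r <= u * (\sum_(i < N) (outcome X w i)%:R - N%:R * p)].
    by apply/seteqP; split => w /=; rewrite sum_outcome.
  exact: (measurable_outcome X (fun b => is_true (r <= u * (\sum_i (b i)%:R - N%:R * p)))).
have tail_le u : u ^+ 2 = t ^+ 2 -> u <= 2^-1 ->
    (P (tail u) <= (expR (- (N%:R * delta ^+ 2 / (8 * q))))%:E)%E.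
  move=> ut u2; apply: le_trans (chernoff_bernoulli _ _ _ _ _ p01 u2 trials) _.
  rewrite lee_fin ler_expR ut.
  have -> : N%:R * delta ^+ 2 / (8 * q) = r - 2 * N%:R * q * t ^+ 2.
    by rewrite /r /t; field; rewrite gt_eqF.
  by rewrite opprB lerB // ler_wpM2r ?sqr_ge0 // ler_wpM2l.
have sub : [set w | delta < `|freq R X w - p|] `<=` tail t `|` tail (- t).
  move=> w /=; pose S : R := \sum_(i < N) (X i w)%:R.
  have -> : freq R X w - p = (S - N%:R * p) / N%:R.
    by rewrite /freq -/S; field; rewrite gt_eqF.
  rewrite normrM normfV (gtr0_norm N0R) ltr_pdivlMr // lter_normr.
  rewrite /tail /r /= -/S => /orP[h|h]; [left|right].
    by rewrite mulrC ler_wpM2l ?(ltW t0) // mulrC ltW.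
  by rewrite mulNr -mulrN mulrC ler_wpM2l ?(ltW t0) // mulrC ltW.
apply: (@le_trans _ _ (P (tail t `|` tail (- t)))).
  by apply: le_measure => //; rewrite inE; [exact: measurable_freq_tail|exact: measurableU].
apply: le_trans (measureU2 _ _ _) _ => //.
rewrite mulrDl mul1r EFinD leeD // tail_le ?sqrrN //.
by apply: le_trans (ltW _) (ltW _ : 0 <= 2^-1); rewrite ?oppr_lt0 ?invr_gt0.
Qed.

End BernoulliTails.

(** * Error propagation from the frequencies to the loss *)

Lemma loss_estimate_accurate {R : realType} (s c eps pH ps : R) :
  0 < s -> `|c| <= 1 -> 0 < eps < 1 ->
  `|pH - (1 + s * c) / 2| <= eps * s / 8 ->
  `|ps - s ^+ 2| <= eps / 8 * s ^+ 2 ->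
  0 < ps /\ `|loss_estimate pH ps - (2 - 2 * c)| <= eps.
Proof.
move=> s0 c1 /andP[e0 e1] hH hs.
have s20 : 0 < s ^+ 2 by rewrite exprn_gt0.
move: hs; rewrite ler_norml => /andP[hs1 hs2].
have ps0 : 0 < ps by nra.
split=> //; rewrite /loss_estimate.
have := sqr_sqrtr (ltW ps0); have : 0 < Num.sqrt ps by rewrite sqrtr_gt0.
move: (Num.sqrt ps) => s' s'0 s'E.
have lo : (1 - eps / 8) * s <= s'.
  rewrite leNgt; apply/negP => h.
  have : s' ^+ 2 < ((1 - eps / 8) * s) ^+ 2 by rewrite ltr_pXn2r ?nnegrE //; nra.
  by rewrite s'E; nra.
have hi : s' <= (1 + eps / 8) * s.
  rewrite leNgt; apply/negP => h.
  have : ((1 + eps / 8) * s) ^+ 2 < s' ^+ 2 by rewrite ltr_pXn2r ?nnegrE //; nra.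
  by rewrite s'E; nra.
(* The numerator is at most [2 * (eps * s / 8) + 4 * (eps * s / 8) = 3/4 * eps * s] in absolute
   value, and [s' >= 7/8 * s] leaves room for the division. *)
have -> : 2 - (4 * pH - 2) / s' - (2 - 2 * c)
    = (2 * (c * (s' - s)) - 4 * (pH - (1 + s * c) / 2)) / s'.
  by field; rewrite gt_eqF.
rewrite normrM normfV (gtr0_norm s'0) ler_pdivrMr //.
have cs : `|c * (s' - s)| <= eps / 8 * s.
  rewrite normrM -[leRHS]mul1r ler_pM // ler_norml; lra.
move: cs hH; rewrite !ler_norml => /andP[? ?] /andP[? ?].
by apply/andP; split; nra.
Qed.

(** * Failure probability and sample size *)

Section Accuracy.
Context {R : realType} {nx : nat} (uobs : 'cV[R]_nx) (uT : 'cV[R[i]]_nx).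
Variables (s c eps : R).
Hypotheses (s01 : 0 < s <= 1) (c1 : `|c| <= 1) (eps01 : 0 < eps < 1).
Hypothesis lossE : norm_loss uobs uT = 2 - 2 * c.
Context {d : measure_display} {T : measurableType d} {P : probability T R}.

Lemma measurable_accurate NH Nq
    (X : 'I_NH -> {RV P >-> bool}) (Y : 'I_Nq -> {RV P >-> bool}) :
  measurable (accurate uobs uT eps X Y).
Proof.
(* The event involves both experiments, so the two families are merged into one, indexed by a sum
   type, to have a single outcome vector. *)
pose Z k : {RV P >-> bool} := match k with inl i => X i | inr j => Y j end.
pose fX (b : {ffun 'I_NH + 'I_Nq -> bool}) : R := (\sum_i (b (inl i))%:R) / NH%:R.
pose fY (b : {ffun 'I_NH + 'I_Nq -> bool}) : R := (\sum_j (b (inr j))%:R) / Nq%:R.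
have -> : accurate uobs uT eps X Y = [set w | 0 < fY (outcome Z w) /\
    `|loss_estimate (fX (outcome Z w)) (fY (outcome Z w)) - norm_loss uobs uT| <= eps].
  have EX w : fX (outcome Z w) = freq R X w.
    by congr (_ / _); apply: eq_bigr => i _; rewrite ffunE.
  have EY w : fY (outcome Z w) = freq R Y w.
    by congr (_ / _); apply: eq_bigr => i _; rewrite ffunE.
  by apply/seteqP; split => w; rewrite /accurate /= EX EY.
exact: (measurable_outcome Z (fun b => 0 < fY b /\
  `|loss_estimate (fX b) (fY b) - norm_loss uobs uT| <= eps)).
Qed.

(** Each experiment may fail with probability [rho / 2]. The union bound works for any joint law of
    [X] and [Y]. *)
Lemma accurate_probability NH Nq (rho : R)
    (X : 'I_NH -> {RV P >-> bool}) (Y : 'I_Nq -> {RV P >-> bool}) :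
  (0 < NH)%N -> (0 < Nq)%N -> 0 < rho ->
  512 * ln (4 / rho) / (eps * s) ^+ 2 <= NH%:R ->
  512 * ln (4 / rho) / (eps * s) ^+ 2 <= Nq%:R ->
  bernoulli_trials ((1 + s * c) / 2) X -> bernoulli_trials (s ^+ 2) Y ->
  ((1 - rho)%:E <= P (accurate uobs uT eps X Y))%E.
Proof.
move=> NH0 Nq0 rho0 NHge Nqge trialsX trialsY.
have /andP[s0 s1] := s01; have /andP[e0 e1] := eps01.
pose delta := eps * s / 8; pose delta' := eps / 8 * s ^+ 2.
pose badX := [set w | delta < `|freq R X w - (1 + s * c) / 2|].
pose badY := [set w | delta' < `|freq R Y w - s ^+ 2|].
have mX : measurable badX by exact: measurable_freq_tail.
have mY : measurable badY by exact: measurable_freq_tail.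
have s20 : 0 < s ^+ 2 by rewrite exprn_gt0.
have es0 : 0 < eps * s by rewrite mulr_gt0.
(* Both exponents share the constant 512 = 8 * 8 ^ 2: [delta ^+ 2 / 8] and
   [delta' ^+ 2 / (8 * s ^+ 2)] both equal [(eps * s) ^+ 2 / 512]. The 4 in the logarithm absorbs
   the two tails and the two experiments. *)
have tail_le N : 512 * ln (4 / rho) / (eps * s) ^+ 2 <= N%:R ->
    2 * expR (- (N%:R * (eps * s) ^+ 2 / 512)) <= rho / 2.
  rewrite ler_pdivrMr ?exprn_gt0 // => h.
  rewrite (_ : rho / 2 = 2 * expR (- ln (4 / rho))).
    by rewrite ler_wpM2l // ler_expR lerN2; lra.
  by rewrite expRN lnK ?posrE ?divr_gt0 //; field; rewrite gt_eqF.
have sc1 : `|s * c| <= 1 by rewrite normrM (gtr0_norm s0) mulr_ile1 // ltW.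
have PX : (P badX <= (rho / 2)%:E)%E.
  apply: le_trans (freq_tail _ _ 1 _ _ NH0 _ _ _ _ trialsX) _ => //.
  - by move: sc1; rewrite ler_norml; lra.
  - by move: sc1; rewrite ler_norml; lra.
  - by rewrite /delta; apply/andP; split; nra.
  rewrite lee_fin; apply: le_trans (tail_le _ NHge); rewrite le_eqVlt.
  by apply/orP; left; apply/eqP; congr (2 * expR _); rewrite /delta; field.
have PY : (P badY <= (rho / 2)%:E)%E.
  apply: le_trans (freq_tail _ _ (s ^+ 2) _ _ Nq0 _ _ _ _ trialsY) _ => //.
  - by rewrite sqr_ge0 expr_le1 // ltW.
  - by rewrite /delta'; apply/andP; split; nra.
  rewrite lee_fin; apply: le_trans (tail_le _ Nqge); rewrite le_eqVlt.
  apply/orP; left; apply/eqP; congr (2 * expR _); rewrite /delta'; field.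
  by rewrite gt_eqF.
have sub : ~` (badX `|` badY) `<=` accurate uobs uT eps X Y.
  move=> w /not_orP[/negP + /negP]; rewrite -!leNgt => hX hY.
  by rewrite /accurate /= lossE; apply: (@loss_estimate_accurate _ s).
apply: (@le_trans _ _ (P (~` (badX `|` badY)))); last first.
  apply: le_measure => //; rewrite inE; last exact: measurable_accurate.
  by apply: measurableC; exact: measurableU.
rewrite probability_setC; last exact: measurableU.
rewrite EFinB leeB // (le_trans (measureU2 _ _ _)) //.
by rewrite [rho]splitr EFinD leeD.
Qed.

End Accuracy.

(* As [rho] tends to 1 the rate tends to 0, while the number of samples does not;
   the bound [ln (1 / rho) >= ln (1 / rho0) > 0] absorbs [ln 4] and the rounding. *)
Lemma sample_size_rate {R : realType} (s eps rho rho0 : R) :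
  0 < s <= 1 -> 0 < eps < 1 -> 0 < rho -> rho <= rho0 < 1 ->
  2 * (512 * ln (4 / rho) / (eps * s) ^+ 2 + 1)
    <= (1024 + (1024 * ln 4 + 2) / ln (rho0^-1)) * (ln (rho^-1) / (s * eps) ^+ 2).
Proof.
move=> /andP[s0 s1] /andP[e0 e1] rho_gt0 /andP[rho_le rho0_lt1].
have rho00 : 0 < rho0 by exact: lt_le_trans rho_le.
pose L := ln (rho^-1); pose L0 := ln (rho0^-1).
have L00 : 0 < L0 by rewrite ln_gt0 // invf_gt1.
have L0L : L0 <= L by rewrite ler_ln ?posrE ?invr_gt0 // lef_pV2 ?posrE.
have l4 : 0 < ln (4 : R) by rewrite ln_gt0 //; lra.
have -> : ln (4 / rho) = ln 4 + L by rewrite lnM ?posrE ?invr_gt0 //; lra.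
rewrite -/L -/L0.
have es0 : 0 < (eps * s) ^+ 2 by rewrite exprn_gt0 // mulr_gt0.
have es1 : (eps * s) ^+ 2 <= 1.
  by rewrite expr_le1 ?mulr_ge0 ?mulr_ile1 // ltW.
rewrite [s * eps]mulrC; move: (_ ^+ 2) es0 es1 => k k0 k1.
rewrite mulrA ler_pdivlMr //.
have -> : 2 * (512 * (ln 4 + L) / k + 1) * k = 1024 * (ln 4 + L) + 2 * k.
  by field; rewrite gt_eqF.
(* Since [k <= 1], the terms free of [L] add up to at most [1024 * ln 4 + 2]; [L >= L0] turns this
   constant into a multiple of [L]. *)
have bound (A : R) : 0 <= A -> A <= A / L0 * L.
  by move=> A0; rewrite mulrAC ler_pdivlMr // ler_wpM2l.
have A0 : 0 <= 1024 * ln 4 + 2 :> R by lra.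
rewrite [leRHS]mulrDl; apply: le_trans (lerD (lexx _) (bound _ A0)); lra.
Qed.

(** * Assembly of the circuit analysis, the tail bounds and the query count *)

Theorem lemma4p3 (R : realType) :
  exists C : R -> R, (forall rho0 : R, 0 < rho0 < 1 -> 0 < C rho0) /\
  forall (nx a : nat) (u0 uobs : 'cV[R]_nx) (uT : 'cV[R[i]]_nx) (lambda : R)
    (Oprep : 'M[R[i]]_nx) (Oobs Usolver : 'M[R[i]]_(2 ^ a * nx))
    (solver : circuit R nx a (2 ^ a * nx)) (Phi : 'cV[R[i]]_(2 ^ a * nx)),
  (0 < nx)%N ->
  u0 != 0 -> uobs != 0 -> uT != 0 ->
  0 < lambda ->
  vnorm uT <= lambda * vnorm (cplx u0) ->
  Oprep \is unitarymx -> Oprep *m ket R nx 0 = amp (cplx u0) ->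
  Oobs \is unitarymx -> Oobs *m zero_state R nx a = encoded a (cplx uobs) ->
  Usolver \is unitarymx ->
  run Oprep Oobs solver = Usolver ->
  prep_queries solver = 1%N -> obs_queries solver = 0%N ->
  Usolver *m zero_state R nx a =
    (vnorm uT / (lambda * vnorm (cplx u0)))%:C *: encoded a uT + Phi ->
  proj_u R nx a *m Phi = 0 ->
  0 < p_H Oprep Oobs solver ->
  0 < p_succ Oprep Oobs solver ->
  [/\ prep_queries (overlap_test solver) = 1%N,
   obs_queries (overlap_test solver) = 1%N,
   prep_queries (succ_test solver) = 1%N &
   forall rho eps : R, 0 < rho < 1 -> 0 < eps < 1 ->
   exists NH Nq : nat,
   [/\ (0 < NH)%N, (0 < Nq)%N,
    forall (d : measure_display) (T : measurableType d) (P : probability T R)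
      (X : 'I_NH -> {RV P >-> bool}) (Y : 'I_Nq -> {RV P >-> bool}),
      bernoulli_trials (p_H Oprep Oobs solver) X ->
      bernoulli_trials (p_succ Oprep Oobs solver) Y ->
      ((1 - rho)%:E <= P (accurate uobs uT eps X Y))%E &
    forall rho0 : R, rho <= rho0 < 1 ->
      let rate := lambda ^+ 2 * vnorm (cplx u0) ^+ 2
                  / (vnorm uT ^+ 2 * eps ^+ 2) * ln (rho^-1) in
      (total_queries (@prep_queries R nx a) solver NH Nq)%:R <= C rho0 * rate /\
      (total_queries (@obs_queries R nx a) solver NH Nq)%:R <= C rho0 * rate]].
Proof.
exists (fun rho0 => 1024 + (1024 * ln 4 + 2) / ln (rho0^-1)); split.
  move=> rho0 /andP[rho00 rho01].
  have l4 : 0 < ln (4 : R) by rewrite ln_gt0 //; lra.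
  have L00 : 0 < ln (rho0^-1) by rewrite ln_gt0 // invf_gt1.
  have A0 : 0 < 1024 * ln 4 + 2 :> R by lra.
  by have := divr_gt0 A0 L00; lra.
move=> nx a u0 uobs uT lambda Oprep Oobs Usolver solver Phi nx0 u0_neq0 uobs_neq0.
move=> uT_neq0 lambda0 uT_le _ _ Oobs_unitary obs_out Usolver_unitary runE.
move=> prep1 obs0 solver_out proj_Phi _ _.
have cplx_neq0 (v : 'cV[R]_nx) : v != 0 -> cplx v != 0.
  by rewrite map_mx_eq0.
have n0 : 0 < vnorm (cplx u0) by rewrite vnorm_gt0 // cplx_neq0.
have nT : 0 < vnorm uT by exact: vnorm_gt0.
rewrite -runE in solver_out Usolver_unitary.
set s := vnorm uT / (lambda * vnorm (cplx u0)) in solver_out.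
pose c := complex.Re (cdot (amp (cplx uobs)) (amp uT)).
have s0 : 0 < s by rewrite divr_gt0 // mulr_gt0.
have s01 : 0 < s <= 1 by rewrite s0 ler_pdivrMr ?mulr_gt0 // mul1r.
have c1 : `|c| <= 1 by rewrite Re_cdot_unit // vnorm_amp // cplx_neq0.
have lossE : norm_loss uobs uT = 2 - 2 * c by rewrite /c Re_cdot_amp.
have psE := p_succE _ _ _ _ _ _ (ltW s0) uT_neq0 solver_out proj_Phi.
have pHE := p_HE _ _ _ _ _ _ solver_out proj_Phi _ nx0 Usolver_unitary
  Oobs_unitary obs_out.
rewrite psE pHE; split=> //=; rewrite ?prep1 ?obs0 //.
move=> rho eps /andP[rho0 rho1] eps01; have /andP[e0 e1] := eps01.
pose M := 512 * ln (4 / rho) / (eps * s) ^+ 2.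
have l0 : 0 <= ln (4 / rho) by rewrite ln_ge0 // ler_pdivlMr //; lra.
have M0 : 0 <= M.
  by apply: divr_ge0 (sqr_ge0 _); apply: mulr_ge0 l0; exact: ler0n.
(* One size serves both experiments. The successor makes it positive and larger than [M], yet at
   most [M + 1]. *)
pose N := (Num.truncn M).+1.
have /andP[NleM MltN] := truncn_itv M0.
exists N, N; split=> // [d T P X Y|rho0' rho_le].
  by apply: accurate_probability => //; rewrite ltW.
have rate_le := sample_size_rate _ _ _ _ s01 eps01 rho0 rho_le.
have totalP : N%:R + N%:R <= 2 * (M + 1) by rewrite /N mulrSr; lra.
have -> : lambda ^+ 2 * vnorm (cplx u0) ^+ 2 / (vnorm uT ^+ 2 * eps ^+ 2) *
    ln (rho^-1) = ln (rho^-1) / (s * eps) ^+ 2.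
  by rewrite /s; field; rewrite !gt_eqF.
(* Both circuits query [Oprep] once, for a total of [N + N]; only the overlap test queries [Oobs],
   for a total of [N]. *)
rewrite /total_queries /= prep1 obs0 !muln0 !addn0 !add0n !muln1 natrD.
split; first exact: le_trans rate_le.
by apply: le_trans rate_le; apply: le_trans totalP; rewrite lerDl.
Qed.
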